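(* Let $C\ge1$, $\alpha\in(0,1)$, and let $(\mathbb{P}_n)_{n\ge0}$ be a prefix-heavy sequence of measures on tuples of reduced words with parameters $(C,\alpha)$, determined by length measures $(\mathbb{T}_n)_n$ and a prefix-heavy sequence $(\mathbb{R}_n)_n$ on reduced words, and suppose that $\liminf_n\mathbb{R}_n(\mathcal{C}_n)=p>0$, where $\mathcal{C}_n$ is the set of cyclically reduced words of length $n$. Let $\lambda\in(0,\frac12)$. If there exists a sequence $(\eta_n)_{n\ge0}$ of positive real numbers such that $$\lim_{n\to\infty}\mathbb{P}_n\left(\mathsf{size}^2\,\mathsf{max}^2\,\alpha^{\lambda\,\mathsf{min}}>\eta_n\right)=0\quad\text{and}\quad\lim_{n\to\infty}\eta_n=0,$$ then a random tuple of cyclically reduced words (lengths drawn according to $\mathbb{T}_n$, then each word of length $\ell$ drawn independently according to $\mathbb{R}_\ell$ conditioned on being cyclically reduced) generically satisfies the small cancellation property $C'(\lambda)$. Moreover, if both of these limits converge polynomially (resp. super-polynomially, exponentially) fast, i.e. both sequences are polynomially (resp. super-polynomially, exponentially) small, then Property $C'(\lambda)$ holds polynomially (resp. super-polynomially, exponentially) generically.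
   Context: $A$ is a finite non-empty alphabet, $\tilde A=A\sqcup A^{-1}$, and $\mathcal{R}$ is the set of all reduced words over $\tilde A$ (words with no factor $aa^{-1}$, $a\in\tilde A$), including the empty word; $\mathcal{R}_n$ is the set of reduced words of length $n$. A word is cyclically reduced if it is non-empty, reduced, and its first and last letters are not mutually inverse. For $u\in\mathcal{R}$, $\mathcal{P}(u)$ is the set of reduced words having $u$ as a prefix (empty if $u$ is not reduced). A sequence $(\mathbb{R}_n)_{n\ge0}$ of probability measures on $\mathcal{R}$ is prefix-heavy with parameters $(C,\alpha)$ ($C\ge1$, $0<\alpha<1$) if (1) the support of $\mathbb{R}_n$ is contained in $\mathcal{R}_n$ for every $n$, and (2) for every $n\ge0$ and $u\in\mathcal{R}$ with $\mathbb{R}_n(\mathcal{P}(u))\ne0$, and every $v\in\mathcal{R}$, $\mathbb{R}_n(\mathcal{P}(uv)\mid\mathcal{P}(u))\le C\alpha^{|v|}$ (where $uv$ is the concatenation). A prefix-heavy sequence of measures on tuples of reduced words with parameters $(C,\alpha)$ is a sequence $(\mathbb{P}_n)_{n\ge0}$ of probability measures on the set of all finite tuples of reduced words such that $\mathbb{P}_n(h_1,\dots,h_k)=\mathbb{T}_n(|h_1|,\dots,|h_k|)\prod_{i=1}^k\mathbb{R}_{|h_i|}(h_i)$, where $(\mathbb{T}_n)_n$ is a sequence of probability measures on the set of finite tuples (of size $k\ge1$) of non-negative integers and $(\mathbb{R}_n)_n$ is a prefix-heavy sequence of measures on $\mathcal{R}$ with parameters $(C,\alpha)$. For lengths $\ell$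 with $\mathbb{R}_\ell(\mathcal{C}_\ell)=0$ (where the conditional law is undefined; only finitely many $\ell$) any convention may be used, e.g. counting tuples involving such a length as failures. For a tuple $\vec h=(h_1,\dots,h_k)$: $\mathsf{size}(\vec h)=k$, $\mathsf{min}(\vec h)=\min_i|h_i|$, $\mathsf{max}(\vec h)=\max_i|h_i|$, $\vec h^\pm=(h_1,h_1^{-1},\dots,h_k,h_k^{-1})$. For a tuple $\vec h$ of cyclically reduced words, a piece is a word $u$ with at least two occurrences as a prefix of a cyclic conjugate of an entry of $\vec h^\pm$ (an occurrence is given by an index in the tuple $\vec h^\pm$ and a cyclic starting position in that word). The tuple $\vec h$ satisfies $C'(\lambda)$ if whenever a piece $u$ occurs as a prefix of a cyclic conjugate $w$ of an entry of $\vec h^\pm$, then $|u|<\lambda|w|$. A property holds generically if the probability of its failure tends to $0$ as $n\to\infty$; exponentially (resp. super-polynomially, polynomially) generically if this probability is exponentially (resp. super-polynomially, polynomially) small. A function $g$ with limit $0$ is exponentially small if $g(n)=o(e^{-dn})$ for some $d>0$; super-polynomially small if $g(n)=o(n^{-d})$ for every positive integer $d$; polynomially small if $g(n)=o(n^{-d})$ for some positive integer $d$.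
   Formalization: Tuples consisting only of empty words (max = 0) are not counted as failures of C'(λ); counting them as failures would make the claim false, e.g. when T_n is concentrated on the tuple (0). Other tuples with an entry that is not cyclically reduced do count as failures. *)

(* Defs.v *)
From HB Require Import structures.
From mathcomp Require Import all_boot all_order all_algebra.
From mathcomp Require Import all_classical all_reals all_analysis.
Set Implicit Arguments.
Unset Strict Implicit.
Unset Printing Implicit Defensive.
Import Order.TTheory GRing.Theory Num.Theory.
Import numFieldNormedType.Exports.
Local Open Scope classical_set_scope.
Local Open Scope ring_scope.

(* [seq T], for [T] countable, carries the discrete sigma-algebra, so that a
   [probability (seq T) R] is a probability measure on a countable set. *)
HB.instance Definition _ (T : countType) := isPointed.Build (seq T) [::].
HB.instance Definition _ (T : countType) :=
  @isMeasurable.Build default_measure_display (seq T)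
    (@discrete_measurable (seq T)) (@discrete_measurable0 (seq T))
    (@discrete_measurableC (seq T)) (@discrete_measurableU (seq T)).

(* [inl a] is the letter [a] and [inr a] is its formal inverse. *)
Notation letter A := (A + A)%type.
Notation word A := (seq (letter A)).

Section Words.
Variable A : finType.
Local Notation letter := (letter A).
Local Notation word := (word A).

Definition linv (a : letter) : letter :=
  match a with inl x => inr x | inr x => inl x end.

Definition winv (w : word) : word := rev (map linv w).

Definition reduced (w : word) : bool := sorted (fun a b => b != linv a) w.

Definition cyclically_reduced (w : word) : bool :=
  if w is a :: s then reduced w && (last a s != linv a) else false.

Definition cyc_words (n : nat) : set word :=
  [set w | cyclically_reduced w /\ size w = n].

Definition prefix_cone (u : word) : set word :=
  [set w | reduced w /\ prefix u w].

Definition maxlen (h : seq word) : nat := (\max_(w <- h) size w)%N.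

(* The minimum starts from [maxlen h], which is neutral when [h] is non-empty;
   only non-empty tuples have positive probability below. *)
Definition minlen (h : seq word) : nat := (\big[minn/maxlen h]_(w <- h) size w)%N.

Definition tuple_pm (h : seq word) : seq word :=
  flatten [seq [:: w; winv w] | w <- h].

(* [o = (j, i)] is an index [j] in [tuple_pm h] together with a cyclic starting
   position [i] in the word at that index. *)
Definition occurrence (h : seq word) (u : word) (o : nat * nat) : Prop :=
  let w := nth [::] (tuple_pm h) o.1 in
  [/\ (o.1 < size (tuple_pm h))%N, (o.2 < size w)%N & prefix u (rot o.2 w)].

Definition piece (h : seq word) (u : word) : Prop :=
  exists o o' : nat * nat, [/\ o <> o', occurrence h u o & occurrence h u o'].

Definition small_cancellation (R : realType) (lambda : R) (h : seq word) : Prop :=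
  all cyclically_reduced h /\
  forall u : word, piece h u -> forall o : nat * nat, occurrence h u o ->
    (size u)%:R < lambda * (size (nth [::] (tuple_pm h) o.1))%:R.

(* A tuple with an entry that is not cyclically reduced counts as a failure.
   The only exception is a tuple all of whose entries are empty: there
   [maxlen h = 0], so [size^2 max^2 alpha^(lambda min) = 0] and no assumption on
   that quantity restricts the probability of such tuples. *)
Definition small_cancellation_failure (R : realType) (lambda : R) :
    set (seq word) :=
  [set h | (0 < maxlen h)%N /\ ~ small_cancellation lambda h].

End Words.

Section Measures.
Variables (R : realType) (A : finType).

Definition cond_prob (mu : probability (word A) R) (X Y : set (word A)) : R :=
  fine (mu (X `&` Y)) / fine (mu Y).

Definition prefix_heavy (C alpha : R) (S : nat -> probability (word A) R) : Prop :=
  [/\ 1 <= C, 0 < alpha < 1,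
      forall n (w : word A), S n [set w] <> 0%E -> reduced w /\ size w = n
    & forall n (u v : word A), reduced u -> S n (prefix_cone u) <> 0%E ->
        reduced v ->
        cond_prob (S n) (prefix_cone (u ++ v)) (prefix_cone u)
          <= C * alpha ^+ size v].

(* [mu] is the law of a tuple whose vector of lengths has law [T] and whose
   entries are then drawn independently, an entry of length [l] having law [S l]. *)
Definition tuple_law (T : probability (seq nat) R)
    (S : nat -> probability (word A) R) (mu : probability (seq (word A)) R) : Prop :=
  forall h : seq (word A),
    fine (mu [set h]) =
    fine (T [set map size h]) * \prod_(w <- h) fine (S (size w) [set w]).

Definition prefix_heavy_tuples (C alpha : R) (T : nat -> probability (seq nat) R)
    (S : nat -> probability (word A) R)
    (P : nat -> probability (seq (word A)) R) : Prop :=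
  [/\ prefix_heavy C alpha S,
      forall n, T n [set [::]] = 0%E
    & forall n, tuple_law (T n) S (P n)].

Lemma measurable_cyc_words (n : nat) : measurable (@cyc_words A n).
Proof. by []. Qed.

(* [S l] conditioned on [cyc_words A l]. If this event is [S l]-null, then
   [mnormalize] returns [S l] itself, under which almost no word is cyclically
   reduced. *)
Definition cyc_law (S : nat -> probability (word A) R) (l : nat) :
    probability (word A) R :=
  mnormalize (mrestr (S l) (measurable_cyc_words l)) (S l).

End Measures.

Section Rates.
Variable R : realType.

Definition polynomially_small (g : nat -> R) : Prop :=
  exists2 d : nat, (0 < d)%N & g =o_\oo (fun n : nat => n%:R ^- d : R).

Definition super_polynomially_small (g : nat -> R) : Prop :=
  forall d : nat, (0 < d)%N -> g =o_\oo (fun n : nat => n%:R ^- d : R).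

Definition exponentially_small (g : nat -> R) : Prop :=
  exists2 d : R, 0 < d & g =o_\oo (fun n : nat => expR (- d * n%:R) : R).

End Rates.

(* Main.v *)
(* Let m = floor (lambda * min). A violation of C'(lambda) yields two distinct
   readings of one word of length m inside the tuple, each given by an entry, a
   direction and a cyclic starting position; there are at most (2 size max)^2
   pairs of readings. Fix the lengths of the entries. If the readings lie in
   different entries, one entry has a prescribed cyclic factor; if they lie in
   the same entry in the same direction, a cyclic interval of length m + d has
   period d; if they lie in the same entry in opposite directions, two inverse
   factors of a cyclically reduced word occur, and these cannot overlap. In each
   case m letters, forming at most two blocks, are determined by earlier
   letters, so prefix-heaviness bounds the probability by C^2 alpha^m, and
   conditioning on cyclic reducedness costs a factor 2 / p once the lengths are
   large. Short lengths cause no trouble: they make alpha^(lambda min) exceed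
   eta n for large n, hence are counted in the first hypothesis. *)

Require Import Defs.
From mathcomp Require Import all_boot all_order all_algebra.
From mathcomp Require Import all_classical all_reals all_analysis.
From mathcomp Require Import zify ring lra.
Import Order.TTheory GRing.Theory Num.Theory.
Import numFieldNormedType.Exports.
Local Open Scope classical_set_scope.
Local Open Scope ring_scope.
Set Implicit Arguments.
Unset Strict Implicit.
Unset Printing Implicit Defensive.

(** * Cyclic factors of words and of their inverses *)

Section Words.
Variables (A : finType) (x0 : letter A).
Implicit Types (u v w : word A) (l m p x : nat).

Definition words l : seq (word A) := map val (enum {: l.-tuple (letter A)}).

Lemma mem_words l w : (w \in words l) = (size w == l).
Proof.
apply/mapP/eqP => [[t _ ->]|<-]; first exact: size_tuple.
by exists (in_tuple w); rewrite ?mem_enum.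
Qed.

Lemma words_uniq l : uniq (words l).
Proof. by rewrite map_inj_uniq ?enum_uniq //; exact: val_inj. Qed.

Lemma linvK : involutive (@linv A).
Proof. by case. Qed.

Lemma linv_neq (b : letter A) : linv b != b.
Proof. by case: b. Qed.

Lemma size_winv w : size (winv w) = size w.
Proof. by rewrite size_rev size_map. Qed.

Lemma winvK : involutive (@winv A).
Proof. by move=> w; rewrite /winv map_rev revK mapK //; exact: linvK. Qed.

Definition cnth w i := nth x0 w (i %% size w).

Definition cfactor p m w : word A := mkseq (fun t => cnth w (p + t)) m.

Definition signed_cfactor (s : bool) p m w :=
  if s then winv (cfactor p m w) else cfactor p m w.

Lemma size_cfactor p m w : size (cfactor p m w) = m.
Proof. exact: size_mkseq. Qed.

Lemma nth_cfactor p m w t : (t < m)%N ->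
  nth x0 (cfactor p m w) t = cnth w (p + t).
Proof. by move=> tm; rewrite nth_mkseq. Qed.

Lemma nth_winv w t : (t < size w)%N ->
  nth x0 (winv w) t = linv (nth x0 w (size w - t.+1)).
Proof.
move=> tw; rewrite nth_rev ?size_map // (nth_map x0) //; lia.
Qed.

Lemma cnth_small w i : (i < size w)%N -> cnth w i = nth x0 w i.
Proof. by move=> iw; rewrite /cnth modn_small. Qed.

Lemma cnth_wrap w i j : i = (j + size w)%N -> cnth w i = cnth w j.
Proof. by move=> ->; rewrite /cnth modnDr. Qed.

Lemma take_rot p m w : (p < size w)%N -> (m <= size w)%N ->
  take m (rot p w) = cfactor p m w.
Proof.
move=> pw mw; apply: (@eq_from_nth _ x0).
  by rewrite size_cfactor size_takel ?size_rot.
move=> t; rewrite size_takel ?size_rot // => tm.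
rewrite nth_take // nth_cfactor // /rot nth_cat size_drop nth_drop.
case: ltnP => h; first by rewrite cnth_small //; lia.
rewrite (@cnth_wrap _ _ (p + t - size w)) 1?cnth_small ?nth_take; try lia.
by congr nth; lia.
Qed.

(** Letter [t] read from position [p] of [winv w] inverts the letter of [w] at
    [size w - (p + t) - 1], taken cyclically. The second [size w] keeps the natural subtraction
    exact before reduction modulo [size w]. *)
Lemma take_rot_winv p m w : (p < size w)%N -> (m <= size w)%N ->
  take m (rot p (winv w)) = winv (cfactor ((size w + size w - p - m) %% size w) m w).
Proof.
move=> pw mw; rewrite take_rot ?size_winv //.
apply: (@eq_from_nth _ x0) => [|t]; rewrite size_cfactor.
  by rewrite size_winv size_cfactor.
move=> tm; rewrite nth_winv ?size_cfactor // !nth_cfactor; try lia.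
rewrite /cnth size_winv nth_winv ?ltn_pmod; try lia.
congr (linv (nth x0 w _)).
rewrite modnDml.
case: (ltnP (p + t) (size w)) => h.
  rewrite (modn_small h).
  have -> : (size w + size w - p - m + (m - t.+1) = size w - (p + t).+1 + size w)%N by lia.
  by rewrite modnDr modn_small //; lia.
have -> : (p + t = (p + t - size w) + size w)%N by lia.
rewrite modnDr modn_small; last lia.
by rewrite modn_small; lia.
Qed.

Lemma reduced_nth w i : reduced w -> (i.+1 < size w)%N ->
  nth x0 w i.+1 != linv (nth x0 w i).
Proof. by move=> /(sortedP x0) h; exact: h. Qed.

Lemma cyclically_reduced_cnth w i : cyclically_reduced w ->
  cnth w i.+1 != linv (cnth w i).
Proof.
case: w => // b s /=; set w := b :: s => /andP[rw cw].
have w0 : (0 < size w)%N by [].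
rewrite /cnth -addn1 -modnDml addn1.
move: (i %% size w)%N (ltn_pmod i w0) => j.
rewrite leq_eqVlt => /predU1P[jw|jw]; last by rewrite modn_small ?reduced_nth.
have -> : j = (size w).-1 by rewrite -jw.
rewrite nth_last prednK // modnn /=.
by apply: contra cw => /eqP e; rewrite [X in linv X]e linvK.
Qed.

End Words.

(** * Mass of words with determined letters *)

Section Mass.
Variables (A : finType) (x0 : letter A) (R : realType).
Implicit Types (u v w : word A) (l m p x : nat) (f : word A -> R)
  (E : pred (word A)).

Definition mass f l E := \sum_(w <- words A l | E w) f w.

(* The finite form of prefix-heaviness for the words of length [l]. *)
Definition heavy_weight (c a : R) l f :=
  [/\ forall w, 0 <= f w, mass f l predT <= 1
    & forall u v,
        mass f l (prefix (u ++ v)) <= c * a ^+ size v * mass f l (prefix u)].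

Lemma mass_ge0 f l E : (forall w, 0 <= f w) -> 0 <= mass f l E.
Proof. by move=> f0; exact: sumr_ge0. Qed.

Lemma mass_le f l E E' : (forall w, 0 <= f w) ->
  (forall w, size w = l -> E w -> E' w) -> mass f l E <= mass f l E'.
Proof.
move=> f0 EE'; rewrite /mass big_seq_cond [leRHS]big_seq_cond.
rewrite [leLHS]big_mkcond [leRHS]big_mkcond /=; apply: ler_sum => w _.
rewrite mem_words; case: eqP => //= sw; case: (boolP (E w)) => // Ew.
  by rewrite EE'.
by case: ifP.
Qed.

(** Dependence on earlier letters is phrased as agreement of two words, so no function has to be
    exhibited; it holds vacuously when no word of length [l] satisfies [E]. *)
Definition determined l E x := forall w w', size w = l -> size w' = l ->
  E w -> E w' -> (forall y, (y < x)%N -> nth x0 w y = nth x0 w' y) ->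
  nth x0 w x = nth x0 w' x.

Definition prefixes l E n := undup [seq take n w | w <- words A l & E w].

Lemma prefixesP l E n u : reflect
  (exists w, [/\ size w = l, E w & u = take n w]) (u \in prefixes l E n).
Proof.
rewrite mem_undup; apply: (iffP mapP) => [[w]|[w [sw Ew ->]]].
  by rewrite mem_filter mem_words => /andP[Ew /eqP sw] ->; exists w.
by exists w => //; rewrite mem_filter mem_words sw eqxx Ew.
Qed.

(** An upper approximation of [mass f l E] that decreases as [n] grows, so that words can be
    examined from left to right. *)
Definition prefix_mass f l E n := mass f l (fun w => take n w \in prefixes l E n).

(** The cones over distinct prefixes of the same length are disjoint. *)
Lemma prefix_mass_sum f l E n : (n <= l)%N ->
  prefix_mass f l E n = \sum_(u <- prefixes l E n) mass f l (prefix u).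
Proof.
move=> nl; rewrite /mass (exchange_big_dep xpredT) //=.
rewrite /prefix_mass /mass big_mkcond /= !big_seq; apply: eq_bigr => w.
rewrite mem_words => /eqP sw.
have pE u : u \in prefixes l E n -> prefix u w = (u == take n w).
  by move=> /prefixesP[w' [sw' _ ->]]; rewrite prefixE size_takel ?sw' // eq_sym.
rewrite -big_filter.
have -> : [seq u <- prefixes l E n | prefix u w] =
          [seq u <- prefixes l E n | u == take n w].
  by apply: eq_in_filter => u /pE.
have un : uniq (prefixes l E n) by rewrite undup_uniq.
case: ifPn => h; first by rewrite (filter_pred1_uniq un h) big_seq1.
rewrite big_filter big_seq_cond big_pred0 // => u.
by apply/negP => /andP[hu /eqP eu]; rewrite eu (negbTE h) in hu.
Qed.

Lemma prefix_mass_anti f l E n n' : (forall w, 0 <= f w) -> (n <= n')%N ->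
  prefix_mass f l E n' <= prefix_mass f l E n.
Proof.
move=> f0 nn'; apply: mass_le => // w sw /prefixesP[w' [sw' Ew' e]].
apply/prefixesP; exists w'; split=> //.
by rewrite -(take_takel w nn') -(take_takel w' nn') e.
Qed.

(** Since the block is determined, truncation to [n] letters is injective on the prefixes of length
    [n + m]: each shorter prefix has a single extension, and heaviness charges [c * a ^+ m] for
    it. *)
Lemma prefix_mass_block c a l f E n m : 0 <= c * a ^+ m ->
  heavy_weight c a l f -> (n + m <= l)%N ->
  (forall x, (n <= x < n + m)%N -> determined l E x) ->
  prefix_mass f l E (n + m) <= c * a ^+ m * prefix_mass f l E n.
Proof.
move=> ca0 [f0 _ hf] nml det; rewrite !prefix_mass_sum; try lia.
apply: (@le_trans _ _ (\sum_(u <- prefixes l E (n + m))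
    c * a ^+ m * mass f l (prefix (take n u)))).
  rewrite big_seq [leRHS]big_seq; apply: ler_sum => u.
  move=> /prefixesP[w [sw _ ->]].
  have := hf (take n (take (n + m) w)) (drop n (take (n + m) w)).
  rewrite cat_take_drop size_drop size_takel ?sw //.
  by rewrite addKn.
rewrite -mulr_sumr ler_wpM2l //.
have eqp w w' : size w = l -> size w' = l -> E w -> E w' ->
    take n w = take n w' -> take (n + m) w = take (n + m) w'.
  move=> sw sw' Ew Ew' e.
  (* Agreement spreads through the block one letter at a time; [k] counts the letters of the block
     already known to agree. *)
  suff H k y : (k <= m)%N -> (y < n + k)%N -> nth x0 w y = nth x0 w' y.
    apply: (@eq_from_nth _ x0); first by rewrite !size_takel ?sw ?sw'.
    move=> y; rewrite size_takel ?sw // => ym.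
    by rewrite !nth_take // (H m).
  elim: k y => [|k IH] y km yk.
    by rewrite -(@nth_take n) 1?e ?nth_take //; lia.
  case: (ltnP y (n + k)) => yk'; first by apply: IH => //; lia.
  apply: (det y) => //; first lia.
  by move=> z zy; apply: IH; lia.
rewrite -(big_map (take n) xpredT (fun v => mass f l (prefix v))).
rewrite (perm_big (prefixes l E n)) //.
apply: uniq_perm.
- rewrite map_inj_in_uniq ?undup_uniq // => u v.
  move=> /prefixesP[w [sw Ew ->]] /prefixesP[w' [sw' Ew' ->]].
  by rewrite !take_takel ?leq_addr //; exact: eqp.
- exact: undup_uniq.
move=> u; apply/mapP/prefixesP => [[v /prefixesP[w [sw Ew ->]] ->]|].
  by exists w; rewrite take_takel ?leq_addr.
move=> [w [sw Ew ->]]; exists (take (n + m) w).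
  by apply/prefixesP; exists w.
by rewrite take_takel ?leq_addr.
Qed.

(** Letters outside the blocks cost nothing, as the prefix mass is decreasing; each block costs one
    factor [c]. *)
Lemma mass_two_blocks c a l f E n1 m1 n2 m2 : 1 <= c -> 0 <= a ->
  heavy_weight c a l f -> (n1 + m1 <= n2)%N -> (n2 + m2 <= l)%N ->
  (forall x, (n1 <= x < n1 + m1)%N -> determined l E x) ->
  (forall x, (n2 <= x < n2 + m2)%N -> determined l E x) ->
  mass f l E <= c ^+ 2 * a ^+ (m1 + m2).
Proof.
move=> c1 a0 hw n12 n2l det1 det2; have [f0 f1 hf] := hw.
have ca0 m : 0 <= c * a ^+ m.
  by rewrite mulr_ge0 ?exprn_ge0 // (le_trans _ c1).
have -> : c ^+ 2 * a ^+ (m1 + m2) = c * a ^+ m2 * (c * a ^+ m1).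
  by rewrite exprD; ring.
apply: (@le_trans _ _ (prefix_mass f l E (n2 + m2))).
  by apply: mass_le => // w sw Ew; apply/prefixesP; exists w.
apply: (le_trans (prefix_mass_block (ca0 m2) hw n2l det2)).
apply: ler_wpM2l => //; apply: (le_trans (prefix_mass_anti _ _ f0 n12)).
apply: (le_trans (prefix_mass_block (ca0 m1) hw _ det1)); first lia.
rewrite -[leRHS]mulr1 ler_wpM2l //.
by apply: (le_trans _ f1); exact: mass_le.
Qed.

Lemma mass_one_block c a l f E n m : 1 <= c -> 0 <= a ->
  heavy_weight c a l f -> (n + m <= l)%N ->
  (forall x, (n <= x < n + m)%N -> determined l E x) ->
  mass f l E <= c ^+ 2 * a ^+ m.
Proof.
move=> c1 a0 hw nl det; rewrite -[m]addn0.
by apply: (mass_two_blocks (n2 := l) c1 a0 hw _ _ det); lia.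
Qed.

End Mass.

(** * Coincidences inside one random word *)

Section Coincidences.
Variables (A : finType) (x0 : letter A) (R : realType).
Variables (c a : R) (l : nat) (f : word A -> R).
Hypotheses (c_ge1 : 1 <= c) (a_ge0 : 0 <= a) (f_heavy : heavy_weight c a l f).
Implicit Types (u v w : word A) (m p d t : nat).

Local Notation cnth := (cnth x0).
Local Notation cfactor := (cfactor x0).

Lemma cfactor_eqP p m p' w : reflect
  (forall t, (t < m)%N -> cnth w (p + t) = cnth w (p' + t))
  (cfactor p m w == cfactor p' m w).
Proof.
apply: (iffP eqP) => [e t tm|e].
  by rewrite -(nth_cfactor x0 _ _ tm) e nth_cfactor.
apply: (@eq_from_nth _ x0); rewrite !size_cfactor // => t tm.
by rewrite !nth_cfactor // e.
Qed.

Lemma cfactor_winvP p m p' w :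
  cfactor p m w == winv (cfactor p' m w) ->
  forall t, (t < m)%N -> cnth w (p + t) = linv (cnth w (p' + (m - t.+1))).
Proof.
move=> /eqP e t tm; rewrite -(nth_cfactor x0 _ _ tm) e.
by rewrite nth_winv size_cfactor // nth_cfactor //; lia.
Qed.

(* A cyclic factor wrapping around the end of the word occupies a final and an
   initial segment, hence the two factors [c]. *)
Lemma mass_cfactor p m v : (p < l)%N -> (m <= l)%N ->
  mass f l (fun w => cfactor p m w == v) <= c ^+ 2 * a ^+ m.
Proof.
move=> pl ml.
have det w w' t : (t < m)%N -> cfactor p m w == v -> cfactor p m w' == v ->
    cnth w (p + t) = cnth w' (p + t).
  by move=> tm /eqP e /eqP e'; rewrite -!(nth_cfactor x0 _ _ tm) e e'.
case: (leqP (p + m) l) => pml.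
  apply: (mass_one_block (x0 := x0) (n := p) c_ge1 a_ge0 f_heavy) => // x xp.
  move=> w w' sw sw' Ew Ew' _; rewrite -!cnth_small; try lia.
  have -> : x = (p + (x - p))%N by lia.
  by apply: det => //; lia.
have mE : m = (p + m - l + (l - p))%N by lia.
rewrite [in leRHS]mE.
apply: (mass_two_blocks (x0 := x0) (n1 := 0) (n2 := p) c_ge1 a_ge0 f_heavy);
  try lia; move=> x xp w w' sw sw' Ew Ew' _; rewrite -!cnth_small; try lia.
  rewrite -(@cnth_wrap _ _ w (p + (x + l - p))) ?sw; last lia.
  rewrite -(@cnth_wrap _ _ w' (p + (x + l - p))) ?sw'; last lia.
  by apply: det => //; lia.
have -> : x = (p + (x - p))%N by lia.
by apply: det => //; lia.
Qed.

Lemma cnth_period p m d w i k :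
  (forall t, (t < m)%N -> cnth w (p + t) = cnth w (p + d + t)) ->
  (p <= i)%N -> (i + k * d < p + m + d)%N -> cnth w i = cnth w (i + k * d).
Proof.
move=> per pi; elim: k => [|k IH] ik; first by rewrite addn0.
rewrite IH; last by lia.
have -> : (i + k * d = p + (i + k * d - p))%N by lia.
by rewrite per; [congr cnth; lia|lia].
Qed.

(* The cyclic interval of length [m + d] starting at [p] has period [d]; [m] of
   its letters are determined by earlier ones, and these are chosen so as to
   form at most two blocks. *)
Lemma mass_cyclic_period p m d (E : pred (word A)) :
  (p < l)%N -> (0 < d)%N -> (m + d <= l)%N ->
  (forall w, E w -> forall t, (t < m)%N -> cnth w (p + t) = cnth w (p + d + t)) ->
  mass f l E <= c ^+ 2 * a ^+ m.
Proof.
move=> pl d0 mdl per.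
(* Three ways for a position to be determined: [det] steps back by a multiple of [d] without
   wrapping, [detw] steps forward past the end of the word to its beginning, [det0] steps back
   within the wrapped part. *)
have det i k x : (p <= i)%N -> (i + k * d < p + m + d)%N ->
    (x < l)%N -> (i + k * d < l)%N -> (i < x)%N -> x = (i + k * d)%N ->
    determined x0 l E x.
  move=> pi ik xl ikl ix xE w w' sw sw' Ew Ew' pre; subst x.
  rewrite -!cnth_small ?sw ?sw' //.
  rewrite -(cnth_period (per w Ew) pi ik) -(cnth_period (per w' Ew') pi ik).
  by rewrite !cnth_small ?sw ?sw' ?pre //; lia.
have detw k x : (p <= x < l)%N -> (x + k * d < p + m + d)%N ->
    (l <= x + k * d)%N -> determined x0 l E x.
  move=> /andP[px xl] ik lik w w' sw sw' Ew Ew' pre.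
  rewrite -!cnth_small ?sw ?sw' //.
  rewrite (cnth_period (per w Ew) px ik) (cnth_period (per w' Ew') px ik).
  rewrite (@cnth_wrap _ _ w _ (x + k * d - l)) ?sw; last lia.
  rewrite (@cnth_wrap _ _ w' _ (x + k * d - l)) ?sw'; last lia.
  by rewrite !cnth_small ?sw ?sw' ?pre //; lia.
have det0 x : (d <= x)%N -> (x + l < p + m + d)%N -> determined x0 l E x.
  move=> dx xl w w' sw sw' Ew Ew' pre.
  have e v : size v = l -> E v -> cnth v x = cnth v (x - d).
    move=> sv Ev; rewrite -(@cnth_wrap _ _ v (x + l) x) ?sv //.
    rewrite -(@cnth_wrap _ _ v (x - d + l) (x - d)) ?sv //.
    rewrite (@cnth_period p m d v (x - d + l) 1 (per v Ev)); try lia.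
    by congr cnth; lia.
  rewrite -!cnth_small ?e ?sw ?sw' //; try lia.
  by rewrite !cnth_small ?sw ?sw' ?pre //; lia.
case: (leqP (p + m + d) l) => pmd.
  apply: (mass_one_block (x0 := x0) (n := p + d) c_ge1 a_ge0 f_heavy); first lia.
  by move=> x xp; apply: (@det (x - d)%N 1%N); lia.
(* The interval wraps: it consists of [[p, l)] and [[0, r)]. *)
move rE : (p + m + d - l)%N => r.
(* If the wrapped part contains a full period, that period fixes the rest of [[0, r)] and all of
   [[p, l)]; [k] is [(l - x) / d] rounded up. *)
case: (leqP d r) => dr.
  have -> : m = (r - d + (l - p))%N by lia.
  apply: (mass_two_blocks (x0 := x0) (n1 := d) (n2 := p) c_ge1 a_ge0 f_heavy)
    => [||x xp|x xp]; try lia; first by apply: det0; lia.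
  have := divn_eq (l - x + d.-1) d.
  have := ltn_pmod (l - x + d.-1) d0.
  set k := ((l - x + d.-1) %/ d)%N => h1 h2.
  by apply: (@detw k); lia.
(* If both parts are shorter than a period, one step forward from any of the first [m] positions
   lands in the wrapped part. *)
case: (leqP d (l - p)) => dlp; last first.
  apply: (mass_one_block (x0 := x0) (n := p) c_ge1 a_ge0 f_heavy); first lia.
  by move=> x xp; apply: (@detw 1%N); lia.
(* [q] is the position of the first period [[p, p + d)] whose translate by [k] periods is [l], the
   first wrapped position. *)
have := divn_eq (l - p) d; have := ltn_pmod (l - p) d0.
set k := ((l - p) %/ d)%N; move=> h1 h2; pose q := (l - k * d)%N.
have k0 : (0 < k)%N by rewrite divn_gt0.
have qE : (q + k * d = l)%N by rewrite /q; lia.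
(* The wrapped letters fix [[q, q + r)]; if this stays inside the first period, the second block
   consists of all letters after that period. *)
case: (leqP (q + r) (p + d)) => qr.
  have -> : m = (r + (l - (p + d)))%N by lia.
  apply: (mass_two_blocks (x0 := x0) (n1 := q) (n2 := p + d) c_ge1 a_ge0 f_heavy)
    => [||x xp|x xp]; try lia; first by apply: (@detw k); lia.
  by apply: (@det (x - d)%N 1%N); lia.
(* Otherwise [[q, q + r)] leaves the first period and re-enters it at [p], where [k.+1] periods lead
   to the wrapped part. *)
have -> : m = (q + r - d - p + (l - q))%N by lia.
apply: (mass_two_blocks (x0 := x0) (n1 := p) (n2 := q) c_ge1 a_ge0 f_heavy)
  => [||x xp|x xp]; try lia; first by apply: (@detw k.+1); rewrite ?mulSn; lia.
case: (ltnP x (p + d)) => xpd; first by apply: (@detw k); lia.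
by apply: (@det (x - d)%N 1%N); lia.
Qed.

(** One of the two cyclic distances between [p] and [p'] is at most [l / 2]. Taken as the period, it
    leaves room for an interval of length [m + d], since [m] is at most [l / 2] as well. *)
Lemma mass_cfactor_eq p p' m : (p < l)%N -> (p' < l)%N -> p <> p' ->
  (m.*2 <= l)%N ->
  mass f l (fun w => cfactor p m w == cfactor p' m w) <= c ^+ 2 * a ^+ m.
Proof.
have [f0 _ _] := f_heavy.
wlog pp' : p p' / (p < p')%N => [H|pl pl' _ ml].
  move=> pl pl' ne ml; case: (ltngtP p p') => // h; first exact: H.
  apply: le_trans (H p' p h pl' pl _ ml); last by move=> e; apply: ne.
  by apply: mass_le => // w _; rewrite eq_sym.
case: (leqP (p' - p).*2 l) => h.
  apply: (@mass_cyclic_period p m (p' - p)); try lia.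
  move=> w /cfactor_eqP e t tm; rewrite e //; congr cnth; lia.
(* Going round the end of the word identifies positions modulo [size w], so the event must record
   that this is [l]. *)
have -> : mass f l (fun w => cfactor p m w == cfactor p' m w) =
    mass f l (fun w => (size w == l) && (cfactor p m w == cfactor p' m w)).
  rewrite /mass big_seq_cond [RHS]big_mkcond /= [LHS]big_mkcond /=.
  apply: eq_big_seq => w; rewrite mem_words => sw; by rewrite sw.
apply: (@mass_cyclic_period p' m (p + l - p')); try lia.
move=> w /andP[/eqP sw /cfactor_eqP e] t tm.
by rewrite -e // -(@cnth_wrap _ _ w (p + t + l) (p + t)) ?sw //; congr cnth; lia.
Qed.

(* Two overlapping mutually inverse factors have a common centre, at which a
   letter is its own inverse or is followed by its inverse. *)
Lemma overlapping_inverse p p' m w : cyclically_reduced w ->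
  (forall t, (t < m)%N -> cnth w (p + t) = linv (cnth w (p' + (m - t.+1)))) ->
  (p <= p')%N -> (p' < p + m)%N -> False.
Proof.
(* The matched positions [p + t] and [p' + (m - t.+1)] start at distance [s] and approach each
   other; at [t = s./2] they coincide if [s] is even and are adjacent if it is odd. *)
move=> cw e pp' pm; pose s := (p' - p + m.-1)%N; pose t := s./2.
have := odd_double_half s; rewrite -/t; case: (odd s) => /= sE.
  have /(_ _) := e t; have -> : (p' + (m - t.+1) = (p + t).+1)%N by lia.
  move=> et; have := cyclically_reduced_cnth x0 (p + t) cw.
  by rewrite et ?linvK ?eqxx //; lia.
have /(_ _) := e t; have -> : (p' + (m - t.+1) = p + t)%N by lia.
move=> et; have := linv_neq (cnth w (p + t)).
by rewrite -et ?eqxx //; lia.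
Qed.

(** Overlapping factors are impossible; disjoint ones match their letters in [m] pairs, and the
    later letter of each pair is determined by the earlier one. *)
Lemma mass_cfactor_winv p p' m : (p < l)%N -> (p' < l)%N -> (m.*2 <= l)%N ->
  mass f l (fun w => cyclically_reduced w &&
                     (cfactor p m w == winv (cfactor p' m w))) <= c ^+ 2 * a ^+ m.
Proof.
have [f0 _ _] := f_heavy.
wlog pp' : p p' / (p <= p')%N => [H pl pl' ml|pl pl' ml].
  case: (leqP p p') => h; first exact: H.
  apply: le_trans (H p' p (ltnW h) pl' pl ml); apply: mass_le => // w _.
  by move=> /andP[-> /eqP ->]; rewrite winvK eqxx.
set E := fun w => _.
have rel w : E w -> forall t, (t < m)%N ->
    cnth w (p + t) = linv (cnth w (p' + (m - t.+1))).
  by move=> /andP[_]; exact: cfactor_winvP.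
have rel' w : E w -> forall t, (t < m)%N ->
    cnth w (p' + t) = linv (cnth w (p + (m - t.+1))).
  by move=> /andP[_ /eqP e]; apply: cfactor_winvP; rewrite e winvK.
(* An impossible event has every letter determined, so the common bound applies to it too. *)
have empty : (forall w, size w = l -> E w -> False) ->
    mass f l E <= c ^+ 2 * a ^+ m.
  move=> E0; apply: (mass_one_block (x0 := x0) (n := 0) c_ge1 a_ge0 f_heavy).
    by lia.
  by move=> x _ w w' sw _ Ew; have := E0 w sw Ew.
case: (ltnP p' (p + m)) => p'm.
  apply: empty => w sw Ew; have /andP[cw _] := Ew.
  exact: (overlapping_inverse cw (rel w Ew)).
have det x : (p' <= x < p' + m)%N -> (x < l)%N -> determined x0 l E x.
  move=> xp xl w w' sw sw' Ew Ew' pre; rewrite -!cnth_small ?sw ?sw' //.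
  have -> : x = (p' + (x - p'))%N by lia.
  rewrite rel' ?(rel' w') //; try lia.
  by rewrite !cnth_small ?sw ?sw' ?pre //; lia.
case: (leqP (p' + m) l) => p'ml.
  apply: (mass_one_block (x0 := x0) (n := p') c_ge1 a_ge0 f_heavy) => // x xp.
  by apply: det; lia.
(* The wrapped end of the factor at [p'] may reach the factor at [p]; that overlap is seen after
   moving [p] to [p + l]. *)
case: (ltnP p (p' + m - l)) => h.
  apply: empty => w sw Ew; have /andP[cw _] := Ew.
  apply: (@overlapping_inverse p' (p + l) m w cw); try lia.
  move=> t tm; rewrite rel' // -(@cnth_wrap _ _ w (p + (m - t.+1) + l) (p + (m - t.+1))) ?sw //.
  by congr (linv (cnth w _)); lia.
(* The wrapped end lies before [p] and fixes the first [p' + m - l] letters of the factor at [p];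
   the remaining letters of that factor fix [[p', l)]. *)
have -> : m = (p' + m - l + (l - p'))%N by lia.
apply: (mass_two_blocks (x0 := x0) (n1 := p) (n2 := p') c_ge1 a_ge0 f_heavy)
  => [||x xp|x xp]; try lia; last by apply: det; lia.
move=> w w' sw sw' Ew Ew' pre; rewrite -!cnth_small ?sw ?sw' //; try lia.
have -> : x = (p + (x - p))%N by lia.
rewrite rel ?(rel w') //; try lia.
have e v : size v = l -> cnth v (p' + (m - (x - p).+1)) =
    nth x0 v (p' + (m - (x - p).+1) - l).
  move=> sv; rewrite (@cnth_wrap _ _ v _ (p' + (m - (x - p).+1) - l)) ?sv; last lia.
  by rewrite cnth_small ?sv //; lia.
by rewrite !e // pre //; lia.
Qed.

End Coincidences.

(** * Independent entries and the union bound *)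

Section Tuples.
Variables (A : finType) (x0 : letter A) (R : realType).
Implicit Types (w : word A) (h : seq (word A)) (L : seq nat) (l m : nat).

Definition tuples L : seq (seq (word A)) :=
  foldr (fun l hs => [seq w :: h | w <- words A l, h <- hs]) [:: [::]] L.

Lemma mem_tuples L h : (h \in tuples L) = (map size h == L).
Proof.
elim: L h => [|l L IH] [|w h] //=.
- by apply/negbTE/allpairsP => -[[? ?] []].
rewrite eqseq_cons -mem_words -IH.
apply/allpairsP/andP => [[[w' h'] /= [w'l h'L [-> ->]]]|[wl hL]]; first by [].
by exists (w, h).
Qed.

Lemma tuples_uniq L : uniq (tuples L).
Proof.
elim: L => //= l L IH; apply: allpairs_uniq => //; first exact: words_uniq.
by move=> [w h] [w' h'] _ _ [-> ->].
Qed.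

Definition weight (g : nat -> word A -> R) h := \prod_(w <- h) g (size w) w.

Lemma weight_ge0 g h : (forall l w, 0 <= g l w) -> 0 <= weight g h.
Proof. by move=> g0; apply: prodr_ge0. Qed.

Lemma sum_weight_cons g l L (E : pred (seq (word A))) :
  \sum_(h <- tuples (l :: L) | E h) weight g h =
  \sum_(w <- words A l) g l w * \sum_(h <- tuples L | E (w :: h)) weight g h.
Proof.
rewrite big_mkcond big_allpairs_dep /= !big_seq; apply: eq_bigr => w.
rewrite mem_words => /eqP sw; rewrite mulr_sumr [RHS]big_mkcond.
by apply: eq_bigr => h _; rewrite /weight big_cons sw.
Qed.

Lemma sum_weight g L :
  \sum_(h <- tuples L) weight g h = \prod_(l <- L) mass (g l) l predT.
Proof.
elim: L => [|l L IH]; first by rewrite big_seq1 /weight !big_nil.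
by rewrite (sum_weight_cons _ _ _ predT) /= IH -mulr_suml big_cons.
Qed.

Section Coordinate.
Variable g : nat -> word A -> R.
Hypotheses (g_ge0 : forall l w, 0 <= g l w)
  (g_le1 : forall l, mass (g l) l predT <= 1).

Lemma sum_weight_le1 L : \sum_(h <- tuples L) weight g h <= 1.
Proof.
rewrite sum_weight.
suff /andP[] : 0 <= \prod_(l <- L) mass (g l) l predT <= 1 by [].
apply: (big_ind (fun x => 0 <= x <= 1)) => [|x y /andP[x0' x1] /andP[y0 y1]|l _].
- by rewrite ler01 lexx.
- by rewrite mulr_ge0 ?mulr_ile1.
- by rewrite mass_ge0 ?g_le1.
Qed.

(** Fubini: a bound valid for entry [i] whatever the other entries are survives averaging, as the
    others have total weight at most 1. *)
Lemma sum_weight_coordinate L i (E : pred (seq (word A))) (B : R) :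
  (i < size L)%N -> 0 <= B ->
  (forall h, map size h = L ->
    mass (g (nth 0 L i)) (nth 0%N L i) (fun w => E (set_nth [::] h i w)) <= B) ->
  \sum_(h <- tuples L | E h) weight g h <= B.
Proof.
elim: L i E => [|l L IH] // i E iL B0 EB; rewrite sum_weight_cons.
case: i iL EB => [|i] iL EB.
  under eq_bigr do rewrite mulr_sumr.
  rewrite (exchange_big_dep xpredT) //=.
  apply: (@le_trans _ _ (\sum_(h <- tuples L) weight g h * B)).
    rewrite !big_seq; apply: ler_sum => h; rewrite mem_tuples => /eqP hL.
    under eq_bigr do rewrite mulrC.
    rewrite -mulr_sumr ler_wpM2l ?weight_ge0 //.
    (* A dummy entry of the right length, overwritten by [set_nth]. *)
    apply: le_trans (EB (nseq l x0 :: h) _); first by rewrite lexx.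
    by rewrite /= size_nseq hL.
  by rewrite -mulr_suml -[leRHS]mul1r ler_wpM2r ?sum_weight_le1.
apply: (@le_trans _ _ (\sum_(w <- words A l) g l w * B)).
  rewrite !big_seq; apply: ler_sum => w; rewrite mem_words => /eqP sw.
  rewrite ler_wpM2l //; apply: (IH i) => // h hL.
  by apply: le_trans (EB (w :: h) _); rewrite /= ?lexx ?sw ?hL.
by rewrite -mulr_suml -[leRHS]mul1r ler_wpM2r ?g_le1.
Qed.

Section Coincidence.
Variables (c a kappa : R) (f : nat -> word A -> R) (L : seq nat) (m : nat).
Hypotheses (c_ge1 : 1 <= c) (a_ge0 : 0 <= a) (kappa_ge0 : 0 <= kappa).
Hypothesis f_heavy : forall l, heavy_weight c a l (f l).
Hypothesis g_le : forall l w, l \in L ->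
  g l w <= if cyclically_reduced w then kappa * f l w else 0.
Hypothesis m_le : forall l, l \in L -> (m.*2 <= l)%N.

(** Trades the conditioned law for the unconditioned one at cost [kappa]; words that are not
    cyclically reduced have zero weight on the left. *)
Let mass_g_le l (E E' : pred (word A)) : l \in L ->
  (forall w, size w = l -> cyclically_reduced w -> E w -> E' w) ->
  mass (g l) l E <= kappa * mass (f l) l E'.
Proof.
move=> lL EE'; have [f0 _ _] := f_heavy l.
rewrite /mass mulr_sumr [leLHS]big_mkcond [leRHS]big_mkcond /= !big_seq.
apply: ler_sum => w; rewrite mem_words => /eqP sw; have := @g_le l w lL.
case: (boolP (E w)) => Ew; last by move=> _; case: ifP; rewrite ?mulr_ge0.
case: ifP => cw gw; first by rewrite EE'.
by apply: le_trans gw _; case: ifP; rewrite ?mulr_ge0.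
Qed.

(* The entry read, whether it is read from right to left, with inverted letters,
   and the starting position in that entry. *)
Local Notation reader := (nat * bool * nat)%type.

Definition read (o : reader) h :=
  signed_cfactor x0 o.1.2 o.2 m (nth [::] h o.1.1).

(** The entry seen by [o] is redrawn with the others fixed, which turns a reading of any other entry
    into a constant word. *)
Lemma sum_coincidence (o o' : reader) : o <> o' ->
  (o.1.1 < size L)%N -> (o.2 < nth 0 L o.1.1)%N ->
  (o'.1.1 < size L)%N -> (o'.2 < nth 0 L o'.1.1)%N ->
  \sum_(h <- tuples L | read o h == read o' h) weight g h <=
    kappa * (c ^+ 2 * a ^+ m).
Proof.
case: o o' => [[i s] p] [[i' s'] p'] /= ne iL pl i'L p'l.
have B0 : 0 <= kappa * (c ^+ 2 * a ^+ m).
  by rewrite !mulr_ge0 ?exprn_ge0 // (le_trans _ c_ge1).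
apply: (sum_weight_coordinate iL B0) => h hL.
have lL : nth 0%N L i \in L by rewrite mem_nth.
have ml := m_le lL.
have hi w : nth [::] (set_nth [::] h i w) i = w by rewrite nth_set_nth /= eqxx.
have bound (E' : pred (word A)) : (forall w, size w = nth 0%N L i -> cyclically_reduced w ->
      read (i, s, p) (set_nth [::] h i w) == read (i', s', p') (set_nth [::] h i w) ->
      E' w) ->
    mass (f (nth 0%N L i)) (nth 0%N L i) E' <= c ^+ 2 * a ^+ m ->
    mass (g (nth 0%N L i)) (nth 0%N L i)
      (fun w => read (i, s, p) (set_nth [::] h i w) ==
                read (i', s', p') (set_nth [::] h i w)) <= kappa * (c ^+ 2 * a ^+ m).
  by move=> EE' E'B; apply: (le_trans (mass_g_le lL EE')); rewrite ler_wpM2l.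
case: (eqVneq i i') => ii'; last first.
  pose v := read (i', s', p') h.
  apply: (bound (fun w => cfactor x0 p m w == if s then winv v else v)).
    move=> w _ _; rewrite /v /read /= hi nth_set_nth /= (eq_sym i') (negbTE ii').
    by case: s {bound ne} => /= /eqP <-; rewrite ?winvK.
  by apply: (mass_cfactor x0 c_ge1 a_ge0 (f_heavy _)) => //; lia.
subst i'; case: (eqVneq s s') => ss'.
  subst s'; apply: (bound (fun w => cfactor x0 p m w == cfactor x0 p' m w)).
    move=> w _ _; rewrite /read /= hi; case: s {bound ne} => //=.
    by rewrite (inj_eq (can_inj (@winvK A))).
  apply: (mass_cfactor_eq x0 c_ge1 a_ge0 (f_heavy _)) => // pp'.
  by apply: ne; rewrite pp'.
apply: (bound (fun w => cyclically_reduced w &&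
                        (cfactor x0 p m w == winv (cfactor x0 p' m w)))).
  move=> w _ -> /=; rewrite /read /= hi.
  by case: s s' ss' {bound ne} => -[] //= _ /eqP <-; rewrite winvK.
exact: (mass_cfactor_winv x0 c_ge1 a_ge0 (f_heavy _)).
Qed.

Definition valid (o : reader) := (o.1.1 < size L)%N && (o.2 < nth 0%N L o.1.1)%N.

Definition coincident h :=
  exists o o' : reader, [/\ o <> o', valid o, valid o' & read o h = read o' h].

(** With [k] entries of length at most [M] there are at most [k * 2 * M] valid readers; squaring
    this number gives the factor 4. *)
Lemma sum_coincident (F : pred (seq (word A))) :
  (forall h, map size h = L -> F h -> weight g h != 0 -> coincident h) ->
  \sum_(h <- tuples L | F h) weight g h <=
    4 * (size L)%:R ^+ 2 * (\max_(l <- L) l)%N%:R ^+ 2 * (kappa * (c ^+ 2 * a ^+ m)).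
Proof.
move=> Fc; pose k := size L; pose M := (\max_(l <- L) l)%N.
pose I := ('I_k * bool * 'I_M)%type.
pose r (x : I) : reader := (nat_of_ord x.1.1, x.1.2, nat_of_ord x.2).
have B0 : 0 <= kappa * (c ^+ 2 * a ^+ m).
  by rewrite !mulr_ge0 ?exprn_ge0 // (le_trans _ c_ge1).
pose G (y : I * I) := [&& y.1 != y.2, valid (r y.1) & valid (r y.2)].
apply: (@le_trans _ _ (\sum_(y : I * I | G y)
    \sum_(h <- tuples L | read (r y.1) h == read (r y.2) h) weight g h)).
  rewrite (exchange_big_dep xpredT) //= big_mkcond /= !big_seq.
  apply: ler_sum => h; rewrite mem_tuples => /eqP hL.
  have w0 := weight_ge0 h g_ge0.
  case: ifP => [Fh|_]; last by apply: sumr_ge0.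
  have [->|wn0] := eqVneq (weight g h) 0; first by apply: sumr_ge0.
  have [u [u' [ne vu vu' e]]] := Fc h hL Fh wn0.
  have lift v : valid v -> exists x : I, r x = v.
    case: v => [[i s] p] /andP[/= ik pl].
    have pM : (p < M)%N.
      by apply: (leq_trans pl); apply: (@leq_bigmax_seq _ L xpredT id); rewrite ?mem_nth.
    by exists (Ordinal ik, s, Ordinal pM).
  have [x xu] := lift u vu; have [x' xu'] := lift u' vu'; subst u u'.
  rewrite (bigD1 (x, x')) /=; first by rewrite lerDl sumr_ge0.
  rewrite /G /= vu vu' e eqxx !andbT; apply/eqP => xx'; apply: ne; by rewrite xx'.
apply: (@le_trans _ _ (\sum_(y : I * I | G y) kappa * (c ^+ 2 * a ^+ m))).
  apply: ler_sum => -[x x'] /and3P[/= ne /andP[xL xl] /andP[xL' xl']].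
  apply: sum_coincidence => //.
  move: x x' ne {xL xl xL' xl'} => [[i s] p] [[i' s'] p'] /eqP ne [ii' ss' pp'].
  by apply: ne; rewrite (val_inj ii') ss' (val_inj pp').
rewrite sumr_const -[leLHS]mulr_natl ler_wpM2r //.
apply: (@le_trans _ _ (#|{: I * I}|%:R)); first by rewrite ler_nat max_card.
rewrite !card_prod card_bool !card_ord !natrM -/k -/M.
by rewrite le_eqVlt; apply/orP; left; apply/eqP; ring.
Qed.

End Coincidence.
End Coordinate.
End Tuples.

(** * From a violation of small cancellation to two equal readings *)

Section Failure.
Variables (A : finType) (x0 : letter A) (R : realType).
Implicit Types (u w : word A) (h : seq (word A)).

Lemma size_tuple_pm h : size (tuple_pm h) = (size h).*2.
Proof. by elim: h => //= w h IH; rewrite doubleS -IH. Qed.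

Lemma nth_tuple_pm h j : (j < (size h).*2)%N ->
  nth [::] (tuple_pm h) j =
    if odd j then winv (nth [::] h j./2) else nth [::] h j./2.
Proof.
elim: h j => [|w h IH] [|[|j]] //= jh.
by rewrite negbK; apply: IH; lia.
Qed.

Lemma minlen_le h w : w \in h -> (minlen h <= size w)%N.
Proof.
rewrite /minlen; elim: h (maxlen h) => //= v h IH x.
rewrite inE big_cons geq_min => /predU1P[->|/IH ->]; first by rewrite leqnn.
by rewrite orbT.
Qed.

Lemma minlen_map h :
  minlen h = \big[minn/(\max_(l <- map size h) l)%N]_(l <- map size h) l.
Proof. by rewrite /minlen /maxlen !big_map. Qed.

(** In [tuple_pm] an entry and its inverse sit at consecutive indices, so halving gives the entry
    and parity the direction; the position in an inverse is converted as in [take_rot_winv]. *)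
Definition reader_of m h (o : nat * nat) : nat * bool * nat :=
  let l := size (nth [::] h o.1./2) in
  (o.1./2, odd o.1, if odd o.1 then (l + l - o.2 - m) %% l else o.2)%N.

Lemma reader_of_occurrence m h u o :
  (forall w, w \in h -> (m <= size w)%N) -> (m <= size u)%N ->
  occurrence h u o ->
  valid (map size h) (reader_of m h o) /\ read x0 m (reader_of m h o) h = take m u.
Proof.
case: o => j p mh mu [/=]; rewrite size_tuple_pm => jh.
have jh2 : (j./2 < size h)%N by lia.
have ml := mh _ (mem_nth [::] jh2).
rewrite nth_tuple_pm // /valid /read /reader_of /= size_map jh2 /=.
rewrite (nth_map [::]) // => pl; rewrite prefixE => /eqP <-.
rewrite (take_takel _ mu); case: (odd j) pl => /=.
  rewrite size_winv => pl; rewrite ltn_pmod; last by lia.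
  by rewrite (take_rot_winv x0).
by move=> pl; rewrite pl (take_rot x0).
Qed.

Lemma reader_of_inj m h u o o' :
  (forall w, w \in h -> (m <= size w)%N) ->
  occurrence h u o -> occurrence h u o' ->
  reader_of m h o = reader_of m h o' -> o = o'.
Proof.
case: o o' => j p [j' p'] mh [/= jh pl _] [/= jh' pl' _]; rewrite /reader_of /=.
move: jh jh' pl pl'; rewrite size_tuple_pm => jh jh'; rewrite !nth_tuple_pm //.
have jh2 : (j./2 < size h)%N by lia.
have := mh _ (mem_nth [::] jh2).
move=> ml pl pl' [e1 e2]; have {e1 e2} jj' : j = j'.
  by rewrite -(odd_double_half j) -(odd_double_half j') e1 e2.
subst j'; move: pl pl'; case: (odd j); rewrite ?size_winv => pl pl'; last first.
  by move=> ->.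
move: (size _) ml pl pl' => l ml pl pl' e; congr (_, _).
(* Explicit values of the residue, from which its injectivity in [q] is linear arithmetic. *)
have red q : (q < l)%N -> ((l + l - q - m) %% l =
    if q + m == 0 then 0 else
    if q + m <= l then l - (q + m) else l + l - (q + m))%N.
  rewrite -subnDA => ql; case: eqP => [->|qm]; first by rewrite subn0 addnn -muln2 modnMr.
  case: leqP => h1; last by rewrite modn_small; lia.
  have -> : (l + l - (q + m) = (l - (q + m)) + l)%N by lia.
  by rewrite modnDr modn_small; lia.
move: e; rewrite !red //.
by case: (p + m =P 0)%N; case: (p' + m =P 0)%N;
  case: (leqP (p + m) l); case: (leqP (p' + m) l); lia.
Qed.

(** The occurrence [o] that is too long serves only to show that [u] has at least [m] letters; the
    two readings come from the occurrences that make [u] a piece. *)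
Lemma failure_coincident (lambda : R) m h :
  all (@cyclically_reduced A) h -> ~ small_cancellation lambda h ->
  0 <= lambda -> m%:R <= lambda * (minlen h)%:R ->
  (forall w, w \in h -> (m <= size w)%N) ->
  coincident x0 (map size h) m h.
Proof.
move=> cyc fail l0 mmin mh.
have [u [[ o1 [ o2 [ne h1 h2]]] [ o ho large]]] : exists u, piece h u /\
    exists2 o, occurrence h u o &
      lambda * (size (nth [::] (tuple_pm h) o.1))%:R <= (size u)%:R.
  apply: contrapT => none; apply: fail; split=> // u pu o ho.
  by rewrite ltNge; apply/negP => le; apply: none; exists u; split=> //; exists o.
have mu : (m <= size u)%N.
  rewrite -(ler_nat R); apply: (le_trans mmin); apply: le_trans large.
  rewrite ler_wpM2l // ler_nat; case: ho; rewrite size_tuple_pm => jh _ _.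
  have jh2 : (o.1./2 < size h)%N by lia.
  have := minlen_le (mem_nth [::] jh2); rewrite nth_tuple_pm //.
  by case: ifP; rewrite ?size_winv.
have [v1 r1] := reader_of_occurrence mh mu h1.
have [v2 r2] := reader_of_occurrence mh mu h2.
exists (reader_of m h o1), (reader_of m h o2); split=> //; last by rewrite r1 r2.
by move=> e; apply: ne; exact: (reader_of_inj mh h1 h2 e).
Qed.

End Failure.

(** * Probability measures on countable sets *)

Section DiscreteMeasures.
Variables (U : countType) (R : realType).
Implicit Types (mu nu : probability (seq U) R) (X Y : set (seq U)).

Lemma fine_measureK mu X : (fine (mu X))%:E = mu X.
Proof. by rewrite fineK // fin_num_measure. Qed.

Lemma fine_measure_ge0 mu X : 0 <= fine (mu X).
Proof. exact: fine_ge0. Qed.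

Lemma fine_measure_le mu X Y : X `<=` Y -> fine (mu X) <= fine (mu Y).
Proof. by move=> XY; rewrite -lee_fin !fine_measureK le_measure ?inE. Qed.

Lemma fine_measure_finite mu X (s : seq (seq U)) : uniq s ->
  fine (mu [set h | X h /\ h \in s]) = \sum_(h <- s | `[<X h>]) fine (mu [set h]).
Proof.
elim: s => [_|h s IH] /=.
  by rewrite big_nil (_ : [set _ | _] = set0) ?measure0 // -subset0 => h [].
move=> /andP[hs us]; rewrite big_cons -IH //.
have [Xh|nXh] := asboolP (X h); last first.
  congr (fine (mu _)); apply/seteqP; split=> [g|g [Xg gs]]; last first.
    by split=> //; rewrite inE gs orbT.
  by move=> [Xg]; rewrite inE => /predU1P[gh|//]; rewrite -gh in nXh.
rewrite -fineD ?fin_num_measure // -measureU //.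
  congr (fine (mu _)); apply/seteqP; split=> [g [Xg]|g [->|[Xg gs]]].
  - by rewrite inE => /predU1P[->|gs]; [left|right].
  - by split=> //; rewrite inE eqxx.
  - by split=> //; rewrite inE gs orbT.
by rewrite -subset0 => g [-> []] _; rewrite (negbTE hs).
Qed.

Lemma null_of_points mu X : (forall h, X h -> mu [set h] = 0%E) -> mu X = 0%E.
Proof.
move=> X0; apply/(@negligibleP _ _ _ mu) => //.
pose F n := [set h | X h /\ pickle h = n].
have -> : X = \bigcup_n F n.
  by apply/seteqP; split=> [h Xh|h [n _ []] //]; exists (pickle h).
apply: negligible_bigcup => n; apply/negligibleP => //.
have [[h [Xh hn]]|none] := pselect (exists h, F n h).
  suff -> : F n = [set h] by exact: X0.
  apply/seteqP; split=> [g [_ gn]|g ->] //.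
  by apply: (pcan_inj pickleK); rewrite gn.
suff -> : F n = set0 by rewrite measure0.
by rewrite -subset0 => h Fh; apply: none; exists h.
Qed.

Lemma fine_measure_support mu X (s : seq (seq U)) : uniq s ->
  (forall h, h \notin s -> mu [set h] = 0%E) ->
  fine (mu X) = \sum_(h <- s | `[<X h>]) fine (mu [set h]).
Proof.
move=> us s0; rewrite -fine_measure_finite //; congr fine.
transitivity (mu (X `&` [set` s]) + mu (X `\` [set` s]))%E.
  rewrite -measureU // ?setUIDK // -subset0.
  by move=> h [[_ hs] [_]].
have -> : mu (X `\` [set` s]) = 0%E; last by rewrite adde0.
by apply: null_of_points => h [_ /= /negP hs]; exact: s0.
Qed.

Lemma measure_fibers mu X (key : seq U -> nat) :
  mu X = (\sum_(n <oo) mu (X `&` [set h | key h = n]))%E.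
Proof.
rewrite -measure_semi_bigcup //.
- congr (mu _); apply/seteqP; split=> [h Xh|h [n _ []] //].
  by exists (key h).
- by move=> i j _ _ [h [[_ /= <-] [_ /= <-]]].
Qed.

(** The fibre inequalities are summed, and the total mass 1 of [nu] leaves a single [K]. *)
Lemma fine_measure_le_fibers mu nu X Y (key : seq U -> nat) (K : R) : 0 <= K ->
  (forall h, fine (mu (X `&` [set g | key g = key h])) <=
    fine (nu (Y `&` [set g | key g = key h])) +
      K * fine (nu [set g | key g = key h])) ->
  fine (mu X) <= fine (nu Y) + K.
Proof.
move=> K0 le; rewrite -lee_fin EFinD !fine_measureK -[K%:E]mule1.
rewrite -(probability_setT nu) (measure_fibers mu X key) (measure_fibers nu Y key).
rewrite (measure_fibers nu setT key) -nneseriesZl // -nneseriesD //; last first.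
  by move=> n _ _; rewrite mule_ge0 // lee_fin.
apply: lee_nneseries => // n _; rewrite setTI.
have [[h <-]|none] := pselect (exists h, key h = n).
  by have := le h; rewrite -lee_fin EFinD EFinM !fine_measureK.
suff -> : [set h | key h = n] = set0 by rewrite !setI0 !measure0 mule0 adde0.
by rewrite -subset0 => h hn; apply: none; exists h.
Qed.

End DiscreteMeasures.

Lemma limn_einf_gt (R : realType) (u : (\bar R)^nat) (y : \bar R) :
  (y < limn_einf u)%E -> exists N, forall n, (N <= n)%N -> (y < u n)%E.
Proof.
rewrite limn_einf_lim.
rewrite (cvg_lim _ (@cvg_einfs_sup _ u)) //.
move=> /ereal_sup_gt[_ [N _ <-] yN]; exists N => n Nn.
by apply: (lt_le_trans yN); apply: ereal_inf_lbound; exists n.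
Qed.

(** * Prefix-heavy laws and the estimate for fixed lengths *)

Section Laws.
Variables (A : finType) (x0 : letter A) (R : realType).
Implicit Types (u v w : word A) (l : nat) (h : seq (word A)) (L : seq nat).

Lemma mass_measure_le1 (mu : probability (word A) R) l :
  mass (fun w => fine (mu [set w])) l predT <= 1.
Proof.
have := fine_measure_finite mu setT (words_uniq A l).
rewrite /mass (eq_bigl predT) => [<-|w]; last exact/asboolP.
by rewrite -lee_fin fine_measureK probability_le1.
Qed.

Lemma tuple_law_fiber (T0 : probability (seq nat) R)
    (S : nat -> probability (word A) R) (mu : probability (seq (word A)) R)
    (X : set (seq (word A))) L :
  tuple_law T0 S mu ->
  fine (mu (X `&` [set h | map size h = L])) =
  fine (T0 [set L]) *
    \sum_(h <- tuples A L | `[<X h>]) weight (fun l w => fine (S l [set w])) h.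
Proof.
move=> law.
have -> : X `&` [set h | map size h = L] = [set h | X h /\ h \in tuples A L].
  by apply/seteqP; split=> h [Xh]; rewrite /= mem_tuples => hL; split=> //; apply/eqP.
rewrite fine_measure_finite ?tuples_uniq // mulr_sumr.
rewrite big_seq_cond [RHS]big_seq_cond; apply: eq_bigr => h /andP[].
by rewrite mem_tuples => /eqP hL _; rewrite law hL.
Qed.

Section PrefixHeavy.
Variables (C alpha : R) (S : nat -> probability (word A) R).
Hypothesis S_heavy : prefix_heavy C alpha S.

Let f l w := fine (S l [set w]).

Let S_support l w : S l [set w] <> 0%E -> reduced w /\ size w = l.
Proof. by have [_ _ + _] := S_heavy; exact. Qed.

Let fine_words l (X : set (word A)) :
  fine (S l X) = mass (f l) l (fun w => `[<X w>]).
Proof.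
apply: fine_measure_support; first exact: words_uniq.
move=> w; rewrite mem_words => wl; apply: contrapT => /S_support[_ sw].
by rewrite sw eqxx in wl.
Qed.

Let fine_cone l u : fine (S l (prefix_cone u)) = mass (f l) l (prefix u).
Proof.
rewrite fine_words /mass [LHS]big_mkcond [RHS]big_mkcond /=; apply: eq_bigr => w _.
case: (pselect (S l [set w] = 0%E)) => [w0|/S_support[rw _]].
  by rewrite /f w0 /=; do 2!case: ifP.
congr (if _ then _ else _); apply/asboolP/idP => [[]//|].
by split.
Qed.

Lemma mass_prefix_heavy l : mass (f l) l predT = 1.
Proof.
have := fine_words l setT; rewrite probability_setT /= => ->.
by apply: eq_bigl => w; symmetry; apply/asboolP.
Qed.

(** Without the conditional probability the inequality extends to all [u] and [v]: if [u ++ v] is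
    not reduced or the cone of [u] is null, the left side is 0. *)
Lemma prefix_heavy_weight l : heavy_weight C alpha l (f l).
Proof.
have [C1 /andP[a0 a1] _ heavy] := S_heavy.
have C0 : 0 <= C by rewrite (le_trans _ C1).
split=> [w||u v]; first exact: fine_measure_ge0.
  exact: mass_measure_le1.
rewrite -!fine_cone.
have rhs0 : 0 <= C * alpha ^+ size v * fine (S l (prefix_cone u)).
  by rewrite !mulr_ge0 ?exprn_ge0 ?fine_measure_ge0 // ltW.
have sub : prefix_cone (u ++ v) `<=` prefix_cone u.
  move=> w [rw /prefixP[s ws]]; split=> //; apply/prefixP.
  by exists (v ++ s); rewrite ws catA.
have [ru|nru] := boolP (reduced (u ++ v)); last first.
  suff -> : prefix_cone (u ++ v) = set0 by rewrite measure0.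
  rewrite -subset0 => w [rw /prefixP[s ws]]; apply: (negP nru).
  by move: rw; rewrite ws => /cat_sorted2[].
have [ru' rv] := cat_sorted2 ru.
have [z|nz] := pselect (S l (prefix_cone u) = 0%E).
  rewrite z mulr0; apply: (le_trans (fine_measure_le (S l) sub)).
  by rewrite z.
have pos : 0 < fine (S l (prefix_cone u)).
  rewrite lt_neqAle fine_measure_ge0 andbT eq_sym; apply/eqP => e.
  by apply: nz; rewrite -fine_measureK e.
have := heavy l u v ru' nz rv.
by rewrite /cond_prob (setIidl sub) ler_pdivrMr.
Qed.

Lemma cyc_law_le (q : R) l w : 0 < q -> (q%:E <= S l (cyc_words l))%E ->
  fine (cyc_law S l [set w]) <= if cyclically_reduced w then q^-1 * f l w else 0.
Proof.
move=> q0 ql; rewrite /cyc_law /= /mnormalize /= /mrestr setTI.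
have ev0 : S l (cyc_words l) != 0%E.
  by apply/eqP => e; move: ql; rewrite e lee_fin leNgt q0.
have evy : S l (cyc_words l) != +oo%E.
  by rewrite -fine_measureK.
rewrite (negbTE ev0) (negbTE evy) /= fineM ?fin_num_measure //=.
have [cw|ncw] := boolP (cyclically_reduced w); last first.
  suff -> : [set w] `&` cyc_words l = set0 by rewrite measure0 mul0r.
  by rewrite -subset0 => v [-> [cw _]]; rewrite cw in ncw.
rewrite mulrC; apply: ler_pM; rewrite ?fine_measure_ge0 //.
- by rewrite invr_ge0 fine_measure_ge0.
- rewrite lef_pV2 ?posrE //; first by rewrite -lee_fin fine_measureK.
  by apply: lt_le_trans q0 _; rewrite -lee_fin fine_measureK.
- by apply: fine_measure_le => v [].
Qed.

End PrefixHeavy.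

(* A cyclic factor of length [floor (lambda * min)] is used instead of one of
   real length [lambda * min]; this costs one factor [alpha]. *)
Lemma expr_truncn_le (alpha x : R) : 0 < alpha < 1 -> 0 <= x ->
  alpha ^+ Num.truncn x <= alpha^-1 * alpha `^ x.
Proof.
move=> /andP[a0 a1] x0'; rewrite ler_pdivlMl // -exprS -powR_mulrn ?(ltW a0) //.
apply: ger_powR; first by rewrite a0 ltW.
by apply: ltW; have /andP[] := truncn_itv x0'.
Qed.

Section Fibers.
Variables (C alpha : R) (T0 : probability (seq nat) R)
  (S : nat -> probability (word A) R) (P0 Q0 : probability (seq (word A)) R).
Hypotheses (S_heavy : prefix_heavy C alpha S) (T0_nil : T0 [set [::]] = 0%E)
  (P0_law : tuple_law T0 S P0) (Q0_law : tuple_law T0 (cyc_law S) Q0).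
Variables (q : R) (N : nat).
Hypotheses (q_gt0 : 0 < q)
  (q_le : forall l, (N <= l)%N -> (q%:E <= S l (cyc_words l))%E).
Variables (lambda eta : R).
Hypotheses (lambda_range : 0 < lambda < 2^-1) (eta_ge0 : 0 <= eta)
  (eta_lt : eta < alpha `^ (lambda * N%:R)).

Let bad := [set h : seq (word A) |
  eta < (size h)%:R ^+ 2 * (maxlen h)%:R ^+ 2 * alpha `^ (lambda * (minlen h)%:R)].

(** The factors come from counting pairs of readings, conditioning, two blocks, and rounding
    [lambda * min] down. *)
Definition failure_const := 4 * q^-1 * C ^+ 2 * alpha^-1.

Lemma failure_const_ge0 : 0 <= failure_const.
Proof.
have [C1 /andP[a0 _] _ _] := S_heavy.
by rewrite !mulr_ge0 ?invr_ge0 ?exprn_ge0 ?(ltW q_gt0) ?(ltW a0) ?(le_trans _ C1).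
Qed.

Let fiber h := [set h' : seq (word A) | map size h' = map size h].

(** Size, maximum and minimum are constant on a fibre. A fibre meeting [bad] lies inside it and has
    the same mass under [P0], at least its mass under [Q0]; on any other fibre the union bound is at
    most [failure_const * eta]. *)
Lemma failure_le_fiber h :
  fine (Q0 (small_cancellation_failure lambda `&` fiber h)) <=
  fine (P0 (bad `&` fiber h)) + failure_const * eta * fine (P0 (fiber h)).
Proof.
have [C1 /andP[a0 a1] _ _] := S_heavy; have /andP[l0 l2] := lambda_range.
have K0 := failure_const_ge0; pose L := map size h; set fib := fiber h.
set t := fine (T0 [set L]); have t0 : 0 <= t := fine_measure_ge0 _ _.
pose g l w := fine (cyc_law S l [set w]).
have g0 l w : 0 <= g l w := fine_measure_ge0 _ _.
have g1 l : mass (g l) l predT <= 1 := mass_measure_le1 _ _.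
have fibT (mu : probability (seq (word A)) R) : mu fib = mu (setT `&` fib).
  by rewrite setTI.
have Pfib : fine (P0 fib) = t.
  rewrite fibT (tuple_law_fiber _ _ P0_law) (eq_bigl predT) => [|h']; last first.
    exact/asboolP.
  rewrite sum_weight big1 ?mulr1 // => l _.
  exact: mass_prefix_heavy S_heavy l.
have sizeL h' : fib h' -> [/\ size h' = size h, maxlen h' = maxlen h
    & minlen h' = minlen h].
  move=> e; split; first by rewrite -(size_map size) e size_map.
    by rewrite /maxlen -!(big_map size xpredT id) e.
  by rewrite !minlen_map e.
have [hbad|hgood] := pselect (bad h).
  have -> : bad `&` fib = fib.
    apply/seteqP; split=> [h' []//|h' fh']; split=> //.
    by have [s1 s2 s3] := sizeL _ fh'; rewrite /bad /= s1 s2 s3.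
  apply: (@le_trans _ _ (fine (P0 fib))); last first.
    by rewrite lerDl; apply: mulr_ge0; [exact: mulr_ge0|exact: fine_measure_ge0].
  rewrite Pfib (tuple_law_fiber _ _ Q0_law) -[leRHS]mulr1 ler_wpM2l //.
  apply: (le_trans _ (sum_weight_le1 g0 g1 L)); rewrite big_mkcond /=.
  by apply: ler_sum => h' _; case: ifP => // _; exact: weight_ge0.
apply: (@le_trans _ _ (failure_const * eta * fine (P0 fib))); last first.
  by rewrite lerDr fine_measure_ge0.
rewrite Pfib (tuple_law_fiber _ _ Q0_law) mulrC -/t.
have [L0|Ln0] := eqVneq L [::].
  by rewrite /t L0 T0_nil mulr0 mulr0.
apply: ler_wpM2r => //.
have [max0|maxn0] := eqVneq (maxlen h) 0%N.
  rewrite big_seq_cond big_pred0; first exact: (mulr_ge0 K0 eta_ge0).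
  move=> h'; apply/negP.
  rewrite mem_tuples => /andP[/eqP e] /asboolP[]; have [_ -> _] := sizeL _ e.
  by rewrite max0.
have min_eta : (size h)%:R ^+ 2 * (maxlen h)%:R ^+ 2 *
    alpha `^ (lambda * (minlen h)%:R) <= eta.
  by rewrite leNgt; apply/negP.
have size_gt0 : (0 < size h)%N by rewrite -(size_map size h) lt0n size_eq0.
(* Size and maximum are at least 1 here, so a good fibre has [alpha] to the power [lambda * min] at
   most [eta], which is below the value at [N]. *)
have minN : (N < minlen h)%N.
  rewrite ltnNge; apply/negP => minN; suff : eta < eta by rewrite ltxx.
  apply: (lt_le_trans eta_lt); apply: le_trans min_eta.
  apply: (@le_trans _ _ (alpha `^ (lambda * (minlen h)%:R))).
    apply: ger_powR; first by rewrite a0 ltW.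
    by rewrite ler_wpM2l ?ler_nat // ltW.
  by rewrite ler_peMl ?powR_ge0 // mulr_ege1 // exprn_ege1 // ler1n // lt0n.
pose m := Num.truncn (lambda * (minlen h)%:R).
have lm0 : 0 <= lambda * (minlen h)%:R by rewrite mulr_ge0 // ltW.
have m_le : m%:R <= lambda * (minlen h)%:R.
  by have /andP[] := truncn_itv lm0.
have minL l : l \in L -> (minlen h <= l)%N.
  by move=> /mapP[w wh ->]; exact: minlen_le.
have m2 : (m.*2 <= minlen h)%N.
  rewrite -(ler_nat R) -muln2 natrM.
  apply: (@le_trans _ _ (lambda * (minlen h)%:R * 2)); first by rewrite ler_wpM2r.
  have -> : lambda * (minlen h)%:R * 2 = (lambda * 2) * (minlen h)%:R by ring.
  by rewrite -[leRHS]mul1r ler_wpM2r // -ler_pdivlMr // mul1r ltW.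
have g_le l w : l \in L -> g l w <=
    if cyclically_reduced w then q^-1 * fine (S l [set w]) else 0.
  move=> lL; apply: (cyc_law_le _ q_gt0 (q_le _)).
  by apply: (leq_trans (ltnW minN)); exact: minL.
have coin h' : map size h' = L ->
    `[<small_cancellation_failure lambda h'>] -> weight g h' != 0 -> coincident x0 L m h'.
  move=> hL /asboolP[_ fail] wn0.
  have [_ _ minE] := sizeL _ hL.
  rewrite -hL; apply: (@failure_coincident _ x0 _ lambda) => //.
  (* A tuple of nonzero weight has only cyclically reduced entries, so its failure must come from a
     piece. *)
  - apply/allP => w wh; apply: contraNT wn0 => /negbTE ncw.
    rewrite /weight (big_rem w) //=.
    have lL : size w \in L by rewrite -hL map_f.
    have := g_le _ w lL; rewrite ncw => gw0.
    have -> : g (size w) w = 0 by apply/eqP; rewrite eq_le gw0 g0.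
    by rewrite mul0r.
  - exact: ltW.
  - by rewrite minE.
  - move=> w wh; have lL : size w \in L by rewrite -hL map_f.
    apply: leq_trans (minL _ lL); apply: leq_trans m2.
    by rewrite -addnn leq_addr.
have q0 : 0 <= q^-1 by rewrite invr_ge0 ltW.
have m2L l : l \in L -> (m.*2 <= l)%N.
  by move=> lL; apply: (leq_trans m2); exact: minL.
apply: (le_trans (sum_coincident g0 g1 C1 (ltW a0) q0
  (prefix_heavy_weight S_heavy) g_le m2L coin)).
rewrite size_map big_map -/(maxlen h).
have C0 : 0 <= C by rewrite (le_trans _ C1).
apply: (@le_trans _ _ (failure_const * ((size h)%:R ^+ 2 * (maxlen h)%:R ^+ 2 *
    alpha `^ (lambda * (minlen h)%:R)))); last by rewrite ler_wpM2l.
have -> : failure_const * ((size h)%:R ^+ 2 * (maxlen h)%:R ^+ 2 *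
    alpha `^ (lambda * (minlen h)%:R)) =
  4 * (size h)%:R ^+ 2 * (maxlen h)%:R ^+ 2 *
    (q^-1 * (C ^+ 2 * (alpha^-1 * alpha `^ (lambda * (minlen h)%:R)))).
  by rewrite /failure_const; ring.
rewrite !ler_wpM2l ?mulr_ge0 ?exprn_ge0 //.
by apply: expr_truncn_le => //; rewrite a0.
Qed.

End Fibers.
End Laws.

(** * Comparison of rates of decay *)

Section Asymptotics.
Variable R : realType.
Implicit Types u v e h : nat -> R.

Lemma littleo_le u v e h (K : R) : 0 <= K ->
  (forall n, 0 <= u n) -> (forall n, 0 <= v n) -> (forall n, 0 <= e n) ->
  (\forall n \near \oo, u n <= v n + K * e n) ->
  v =o_\oo h -> e =o_\oo h -> u =o_\oo h.
Proof.
move=> K0 u0 v0 e0 ue /eqoP vo /eqoP eo; apply/eqoP => k k0.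
have K1 : 0 < K + 1 by rewrite ltr_wpDl.
(* [K + 1] replaces [K], which may be 0, as divisor. *)
have k1 : 0 < k / (K + 1) / 2 by rewrite !divr_gt0.
have k2 : 0 < k / 2 by rewrite divr_gt0.
near=> n.
have un : u n <= v n + K * e n by near: n.
have vn : `|v n| <= k / 2 * `|h n| by near: n; exact: vo.
have en : `|e n| <= k / (K + 1) / 2 * `|h n| by near: n; exact: eo.
rewrite (ger0_norm (v0 n)) in vn; rewrite (ger0_norm (e0 n)) in en.
rewrite (ger0_norm (u0 n)); apply: (le_trans un).
have -> : k * `|h n| = k / 2 * `|h n| + (K + 1) * (k / (K + 1) / 2 * `|h n|).
  by field; rewrite gt_eqF.
apply: lerD => //; apply: ler_pM => //; by rewrite lerDl.
Unshelve. all: end_near. Qed.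

Lemma littleo_weaken u h h' :
  (\forall n \near \oo, `|h n| <= `|h' n|) -> u =o_\oo h -> u =o_\oo h'.
Proof.
move=> hh' /eqoP uo; apply/eqoP => k k0; near=> n.
apply: (@le_trans _ _ (k * `|h n|)); first by near: n; exact: uo.
by rewrite (ler_pM2l k0); near: n.
Unshelve. all: end_near. Qed.

Lemma littleo_exprV_le u d d' : (d' <= d)%N ->
  u =o_\oo (fun n => n%:R ^- d : R) -> u =o_\oo (fun n => n%:R ^- d' : R).
Proof.
move=> dd'; apply: littleo_weaken; exists 1%N => // n /= n1.
have n0 : 0 < n%:R :> R by rewrite ltr0n.
rewrite !ger0_norm ?invr_ge0 ?exprn_ge0 ?(ltW n0) //.
by rewrite lef_pV2 ?posrE ?exprn_gt0 // ler_weXn2l // ler1n.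
Qed.

Lemma littleo_expR_le u (d d' : R) : d' <= d ->
  u =o_\oo (fun n => expR (- d * n%:R) : R) ->
  u =o_\oo (fun n => expR (- d' * n%:R) : R).
Proof.
move=> dd'; apply: littleo_weaken; apply: nearW => n.
by rewrite !ger0_norm ?expR_ge0 // ler_expR ler_wpM2r // lerN2.
Qed.

End Asymptotics.

(** * Summation over all length vectors, and the limits *)

Theorem theorem3p20 (R : realType) (A : finType) (A_nonempty : (0 < #|A|)%N)
    (C alpha : R) (C_ge1 : 1 <= C) (alpha01 : 0 < alpha < 1)
    (T : nat -> probability (seq nat) R)
    (S : nat -> probability (word A) R)
    (P : nat -> probability (seq (word A)) R)
    (P_heavy : prefix_heavy_tuples C alpha T S P)
    (p : R) (p_gt0 : 0 < p)
    (S_cyc : limn_einf (fun n : nat => S n (cyc_words n)) = p%:E)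
    (Q : nat -> probability (seq (word A)) R)
    (Q_law : forall n : nat, tuple_law (T n) (cyc_law S) (Q n))
    (lambda : R) (lambda_range : 0 < lambda < 2^-1)
    (eta : nat -> R) (eta_gt0 : forall n : nat, 0 < eta n) :
  let bad := fun n : nat => fine (P n [set h : seq (word A) |
    eta n < (size h)%:R ^+ 2 * (maxlen h)%:R ^+ 2
            * alpha `^ (lambda * (minlen h)%:R)]) in
  let failure := fun n : nat => fine (Q n (small_cancellation_failure lambda)) in
  bad n @[n --> \oo] --> (0 : R) -> eta n @[n --> \oo] --> (0 : R) ->
  [/\ failure n @[n --> \oo] --> (0 : R),
      polynomially_small bad -> polynomially_small eta ->
        polynomially_small failure,
      super_polynomially_small bad -> super_polynomially_small eta ->
        super_polynomially_small failure
    & exponentially_small bad -> exponentially_small eta ->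
        exponentially_small failure].
Proof.
have [S_heavy T_nil P_law] := P_heavy.
have /andP[a0 a1] := alpha01.
move=> bad failure bad0 eta0.
have [b _] : exists2 b : A, b \in [set: A] & true.
  by have /card_gt0P[b _] := A_nonempty; exists b; rewrite ?inE.
(* Strictly below the lower limit [p], so it bounds the probabilities of [cyc_words n] from some [N]
   on. *)
pose q := p / 2; have q0 : 0 < q by rewrite divr_gt0.
have [N qN] : exists N, forall n, (N <= n)%N -> (q%:E < S n (cyc_words n))%E.
  by apply: limn_einf_gt; rewrite S_cyc lte_fin /q; lra.
pose K := failure_const C alpha q.
have K0 : 0 <= K := failure_const_ge0 S_heavy q0.
have b0 n : 0 <= bad n := fine_measure_ge0 _ _.
have f0 n : 0 <= failure n := fine_measure_ge0 _ _.
have e0 n : 0 <= eta n := ltW (eta_gt0 n).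
have le : \forall n \near \oo, failure n <= bad n + K * eta n.
  (* [N] is independent of [n], so this threshold is a fixed positive number and [eta] eventually
     drops below it. *)
  have : \forall n \near \oo, eta n < alpha `^ (lambda * N%:R).
    by apply: (cvgr_lt _ eta0); exact: powR_gt0.
  apply: filterS => n eta_n.
  (* The key encodes the vector of lengths as one integer. *)
  apply: (fine_measure_le_fibers (key := fun h => pickle (map size h))).
    exact: mulr_ge0.
  move=> h.
  have -> : [set g : seq (word A) | pickle (map size g) = pickle (map size h)] =
      [set g | map size g = map size h].
    by apply/seteqP; split=> g /= => [/(pcan_inj pickleK)|->].
  apply: (failure_le_fiber (inl b) S_heavy (T_nil n) (P_law n) (Q_law n) q0 _
    lambda_range (e0 n) eta_n).
  by move=> l Nl; apply: ltW; exact: qN.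
split.
- apply: (@squeeze_cvgr _ _ _ _ (fun=> 0) (fun n => bad n + K * eta n)).
  + by apply: filterS le => n ->; rewrite f0.
  + exact: cvg_cst.
  + by have := cvgD bad0 (cvgM (cvg_cst K) eta0); rewrite mulr0 addr0; exact.
- move=> [d d0 bd] [d' d'0 ed]; exists (minn d d'); first by rewrite leq_min d0.
  apply: (littleo_le K0 f0 b0 e0 le).
    exact: littleo_exprV_le (geq_minl d d') bd.
  exact: littleo_exprV_le (geq_minr d d') ed.
- move=> bd ed d d0; exact: (littleo_le K0 f0 b0 e0 le (bd d d0) (ed d d0)).
- move=> [d d0 bd] [d' d'0 ed]; exists (Num.min d d'); first by rewrite lt_min d0.
  apply: (littleo_le K0 f0 b0 e0 le).
    by apply: littleo_expR_le bd; rewrite ge_min lexx.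
  by apply: littleo_expR_le ed; rewrite ge_min lexx orbT.
Qed.
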